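(* Let $H_1$ and $H_2$ be $n$-Hilbert spaces over $\mathbb{K}$, with $a_2,\dots,a_n\in H_1$ and $b_2,\dots,b_n\in H_2$ fixed and with associated Hilbert spaces $H_F$ and $K_G$. Let $K_1\in\mathcal{B}(H_F)$ and $K_2\in\mathcal{B}(K_G)$, and let $\{f_i\}_{i=1}^\infty$ and $\{g_j\}_{j=1}^\infty$ be sequences in $H_1$ and $H_2$, respectively. Then $\{f_i\}_{i=1}^\infty$ is a $K_1$-frame associated to $(a_2,\dots,a_n)$ for $H_1$ and $\{g_j\}_{j=1}^\infty$ is a $K_2$-frame associated to $(b_2,\dots,b_n)$ for $H_2$ if and only if the sequence $\{f_i\otimes g_j\}_{i,j=1}^\infty$ is a $K_1\otimes K_2$-frame associated to $(a_2\otimes b_2,\dots,a_n\otimes b_n)$ for $H_1\otimes H_2$.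
   Context: Let $\mathbb{K}$ be $\mathbb{R}$ or $\mathbb{C}$. An $n$-inner product on a linear space $H$ over $\mathbb{K}$ with $\dim H\ge n$ is a map $(x,y,x_2,\dots,x_n)\mapsto\langle x,y\,|\,x_2,\dots,x_n\rangle\in\mathbb{K}$ that is linear in $x$, conjugate symmetric in $x,y$, invariant under permutations of $x_2,\dots,x_n$, and satisfies $\langle x_1,x_1\,|\,x_2,\dots,x_n\rangle\ge 0$ with equality iff $x_1,\dots,x_n$ are linearly dependent. Its $n$-norm is $\|x_1,\dots,x_n\|=\sqrt{\langle x_1,x_1\,|\,x_2,\dots,x_n\rangle}$. A sequence $\{x_k\}$ converges to $x$ if $\|x_k-x,x_2,\dots,x_n\|\to0$ for all $x_2,\dots,x_n\in H$, and is Cauchy if $\|x_l-x_k,x_2,\dots,x_n\|\to0$ for all $x_2,\dots,x_n\in H$; $H$ is an $n$-Hilbert space if every Cauchy sequence converges. Let $a_2,\dots,a_n\in H_1$ be fixed and linearly independent, $F=\{a_2,\dots,a_n\}$, $L_F=\operatorname{span}F$. Then $\langle x+L_F,y+L_F\rangle_F=\langle x,y\,|\,a_2,\dots,a_n\rangle_1$ is an inner product on $H_1/L_F$; $H_F$ denotes its Hilbert space completion. Each $x\in H_1$ is identified with its class in $H_F$, and for $f,h\in H_F$ one writes $\langle f,h\,|\,a_2,\dots,a_n\rangle_1$ for $\langle f,h\rangle_F$ and $\|f,a_2,\dots,a_n\|_1$ for $\|f\|_F$. Similarly, with $b_2,\dots,b_n\in H_2$ fixed and linearly independent and $G=\{b_2,\dots,b_n\}$,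 $K_G$ is the Hilbert space obtained from $H_2$ and $\langle\cdot,\cdot\,|\,b_2,\dots,b_n\rangle_2$. $\mathcal{B}(X)$ is the space of bounded linear operators on $X$. For $K_1\in\mathcal{B}(H_F)$, a sequence $\{f_i\}\subseteq H_1$ is a $K_1$-frame associated to $(a_2,\dots,a_n)$ for $H_1$ if there are constants $A,B>0$ such that for all $f\in H_F$: $A\|K_1^*f,a_2,\dots,a_n\|_1^2\le\sum_{i=1}^\infty|\langle f,f_i\,|\,a_2,\dots,a_n\rangle_1|^2\le B\|f,a_2,\dots,a_n\|_1^2$. The definition of $K_2$-frame in $H_2$ (with $K_2\in\mathcal{B}(K_G)$, $f\in K_G$) is analogous. $H_1\otimes H_2$ carries the $n$-inner product and $n$-norm given by $\langle f\otimes g,f'\otimes g'\,|\,f_2\otimes g_2,\dots,f_n\otimes g_n\rangle=\langle f,f'\,|\,f_2,\dots,f_n\rangle_1\langle g,g'\,|\,g_2,\dots,g_n\rangle_2$ and $\|f_1\otimes g_1,\dots,f_n\otimes g_n\|=\|f_1,\dots,f_n\|_1\|g_1,\dots,g_n\|_2$. $H_F\otimes K_G$ is the Hilbert space tensor product, and the same formulas are used for $f\in H_F$, $g\in K_G$ in the first slots and $a_i\otimes b_i$ in the remaining ones. $K_1\otimes K_2$ is the operator with $(K_1\otimes K_2)(f\otimes g)=K_1f\otimes K_2g$. $\{f_i\otimes g_j\}_{i,j}$ is a $K_1\otimes K_2$-frame associated to $(a_2\otimes b_2,\dots,a_n\otimes b_n)$ for $H_1\otimes H_2$ if there are $A,B>0$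 such that for all $f\otimes g\in H_F\otimes K_G$ ($f\in H_F$, $g\in K_G$): $A\|(K_1\otimes K_2)^*(f\otimes g),a_2\otimes b_2,\dots,a_n\otimes b_n\|^2\le\sum_{i,j=1}^\infty|\langle f\otimes g,f_i\otimes g_j\,|\,a_2\otimes b_2,\dots,a_n\otimes b_n\rangle|^2\le B\|f\otimes g,a_2\otimes b_2,\dots,a_n\otimes b_n\|^2$.
   Formalization: The ''if'' direction (tensor frame implies both frames) is stated only for K_1 ≠ 0 and K_2 ≠ 0, since it is false otherwise: take K_2 = 0, K_1 ≠ 0 and all f_i = 0. The ''only if'' direction is stated in full. *)

(* Defs.v *)
From HB Require Import structures.
From mathcomp Require Import all_boot all_order all_algebra sesquilinear.
From mathcomp Require Import complex.
From mathcomp Require Import all_classical all_reals all_analysis.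
From mathcomp Require Import ring lra.
Import Order.TTheory GRing.Theory Num.Theory.
Import numFieldNormedType.Exports.

Set Implicit Arguments.
Unset Strict Implicit.
Unset Printing Implicit Defensive.

Local Open Scope classical_set_scope.
Local Open Scope ring_scope.

Variant scalar_kind := RealScalars | ComplexScalars.

Definition scalars (R : realType) (k : scalar_kind) : numFieldType :=
  match k with RealScalars => R | ComplexScalars => R[i] end.

Definition conjK {R : realType} {k : scalar_kind} :
    scalars R k -> scalars R k :=
  match k with
  | RealScalars => fun x : R => x
  | ComplexScalars => fun z : R[i] => conjc z
  end.

Definition reK {R : realType} {k : scalar_kind} : scalars R k -> R :=
  match k with
  | RealScalars => fun x : R => x
  | ComplexScalars => fun z : R[i] => complex.Re z
  end.

(* The norm of a numFieldType takes its values in that field, hence reK. *)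
Definition absK {R : realType} {k : scalar_kind} (z : scalars R k) : R :=
  reK `|z|.

Section LinearFamilies.
Context {K : numFieldType} {V : lmodType K}.

Definition lin_indep (s : seq V) : Prop :=
  forall c : 'I_(size s) -> K,
    \sum_(i < size s) c i *: s`_i = 0 -> forall i, c i = 0.

Definition lin_span (s : seq V) : set V :=
  [set x | exists c : 'I_(size s) -> K, x = \sum_(i < size s) c i *: s`_i].

End LinearFamilies.

Section NInnerProduct.
Context {R : realType} {k : scalar_kind} {n : nat}.
Context {V : lmodType (scalars R k)}.
Variable nip : V -> V -> n.-1.-tuple V -> scalars R k.

Record n_inner_product : Prop := {
  nip_dim : exists s : n.-tuple V, lin_indep s ;
  nip_linear : forall (y : V) (s : n.-1.-tuple V),
    GRing.linear_for *%R (fun x : V => nip x y s) ;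
  nip_conj : forall (x y : V) (s : n.-1.-tuple V),
    nip x y s = conjK (nip y x s) ;
  nip_perm : forall (x y : V) (s t : n.-1.-tuple V),
    perm_eq s t -> nip x y s = nip x y t ;
  nip_ge0 : forall (x : V) (s : n.-1.-tuple V), 0 <= nip x x s ;
  nip_eq0 : forall (x : V) (s : n.-1.-tuple V),
    nip x x s = 0 <-> ~ lin_indep (x :: s) }.

Definition n_norm (x : V) (s : n.-1.-tuple V) : R :=
  Num.sqrt (reK (nip x x s)).

Definition n_cvg (u : nat -> V) (x : V) : Prop :=
  forall s : n.-1.-tuple V, n_norm (u i - x) s @[i --> \oo] --> (0 : R).

Definition n_cauchy (u : nat -> V) : Prop :=
  forall s : n.-1.-tuple V,
    n_norm (u p.1 - u p.2) s @[p --> (\oo, \oo)] --> (0 : R).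

End NInnerProduct.

Record nHilbert (R : realType) (k : scalar_kind) (n : nat) := NHilbert {
  nh_space :> lmodType (scalars R k) ;
  nip : nh_space -> nh_space -> n.-1.-tuple nh_space -> scalars R k ;
  nipP : n_inner_product nip ;
  nh_complete : forall u : nat -> nh_space,
    n_cauchy nip u -> exists x, n_cvg nip u x }.

Record hilbert (R : realType) (k : scalar_kind) := Hilbert {
  h_space :> completeNormedModType (scalars R k) ;
  inner : {dot h_space for @conjK R k} ;
  h_normE : forall x : h_space, `|x| ^+ 2 = inner x x }.

Definition h_norm {R : realType} {k : scalar_kind} {H : hilbert R k} (x : H) :
  R := reK `|x|.

Record bounded_op (R : realType) (k : scalar_kind) (H : hilbert R k) :=
  BoundedOp {
    op :> {linear H -> H} ;
    op_bounded : bounded_near op (nbhs (0 : H)) }.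

(* The Hilbert space completion of H / span a, for the inner product induced
   by <., . | a>. It is unique up to isometric isomorphism, and h_class sends
   a vector to its class. *)
Record completion (R : realType) (k : scalar_kind) (n : nat)
    (H : nHilbert R k n) (a : n.-1.-tuple H) := Completion {
  c_space :> hilbert R k ;
  h_class : {linear H -> c_space} ;
  h_class_eq : forall x y : H,
    h_class x = h_class y <-> lin_span a (x - y) ;
  h_class_inner : forall x y : H,
    inner c_space (h_class x) (h_class y) = nip x y a ;
  h_class_dense : dense (range h_class) }.

(* The Hilbert space tensor product, unique up to isometric isomorphism. *)
Record hilbert_tensor (R : realType) (k : scalar_kind) (H1 H2 : hilbert R k) :=
  HilbertTensor {
    t_space :> hilbert R k ;
    tens : {bilinear H1 -> H2 -> t_space} ;
    tens_inner : forall (f f' : H1) (g g' : H2),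
      inner t_space (tens f g) (tens f' g') = inner H1 f f' * inner H2 g g' ;
    tens_dense : dense [set \sum_(p <- s) tens p.1 p.2 | s in
                         [set: seq (H1 * H2)]] }.

Section Scalars.
Variables (R : realType) (k : scalar_kind).
Local Notation K := (scalars R k).

Definition ofR : R -> K :=
  match k return R -> scalars R k with
  | RealScalars => fun x => x
  | ComplexScalars => fun x => Complex x 0
  end.

Lemma reKD (x y : K) : reK (x + y) = reK x + reK y.
Proof. by rewrite /reK; case: k x y => //= -[? ?] [? ?]. Qed.

Lemma reKN (x : K) : reK (- x) = - reK x.
Proof. by rewrite /reK; case: k x => //= -[? ?]. Qed.

Lemma reK_conj (x : K) : reK (conjK x) = reK x.
Proof. by rewrite /reK /conjK; case: k x => //= -[? ?]. Qed.

Lemma conjKM (x y : K) : conjK (x * y) = conjK x * conjK y.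
Proof. by rewrite /conjK; case: k x y => //= x y; rewrite rmorphM. Qed.

Lemma conjKK (x : K) : conjK (conjK x) = x.
Proof. by rewrite /conjK; case: k x => //= x; rewrite conjcK. Qed.

Lemma conjK_ofR r : conjK (ofR r) = ofR r.
Proof. by rewrite /conjK /ofR; case: k => //=; rewrite oppr0. Qed.

Lemma reK_ofRM r (x : K) : reK (ofR r * x) = r * reK x.
Proof. by rewrite /reK /ofR; case: k x => //= -[c d]; rewrite /= mul0r subr0. Qed.

Lemma reK_ofR r : reK (ofR r) = r.
Proof. by rewrite /reK /ofR; case: k. Qed.

Lemma ofR0 : ofR 0 = 0.
Proof. by rewrite /ofR; case: k. Qed.

Lemma ofR1 : ofR 1 = 1.
Proof. by rewrite /ofR; case: k. Qed.

Lemma absK_sqrE (x : K) : absK x ^+ 2 = reK (x * conjK x).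
Proof.
rewrite /absK /reK /conjK; case: k x => /= [x|]; first by rewrite -normrX ger0_norm ?sqr_ge0.
by move=> -[a b] /=; rewrite sqr_sqrtr ?addr_ge0 ?sqr_ge0//; ring.
Qed.

Lemma absK_ge0 (x : K) : 0 <= absK x.
Proof.
by rewrite /absK /reK; case: k x => //= -[a b] /=; rewrite sqrtr_ge0.
Qed.

Lemma reK_le_absK (x : K) : reK x ^+ 2 <= absK x ^+ 2.
Proof.
rewrite absK_sqrE /reK /conjK; case: k x => //= -[a b] /=.
by rewrite mulrN opprK expr2 lerDl -expr2 sqr_ge0.
Qed.

Lemma ofR_reK (x : K) : 0 <= x -> x = ofR (reK x).
Proof.
rewrite /ofR /reK; case: k x => //= -[a b] /=.
by rewrite lecE /= => /andP[/eqP -> _].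
Qed.

Lemma absK_eq0 (x : K) : absK x = 0 -> x = 0.
Proof.
rewrite /absK => x0; apply/normr0_eq0; rewrite (ofR_reK (normr_ge0 x)) x0.
by rewrite /ofR; case: k.
Qed.

Lemma ofR_lt r s : (ofR r < ofR s) = (r < s).
Proof. by rewrite /ofR; case: k => //=; rewrite ltcE /= eqxx. Qed.

Lemma reK_gt0 (x : K) : 0 < x -> 0 < reK x.
Proof.
rewrite /reK; case: k x => //= -[a b] /=.
by rewrite ltcE /= => /andP[].
Qed.

Lemma reK_ge0 (x : K) : 0 <= x -> 0 <= reK x.
Proof.
rewrite /reK; case: k x => //= -[a b] /=.
by rewrite lecE /= => /andP[].
Qed.

Lemma absK_sqrD (x y : K) :
  absK (x + y) ^+ 2 <= 2 * (absK x ^+ 2 + absK y ^+ 2).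
Proof.
have h1 (a b : R) : (a + b) * (a + b) <= 2 * (a * a + b * b).
  by have := sqr_ge0 (a - b); rewrite expr2; nra.
have h2 (a b c d : R) :
  (a + b) * (a + b) - (c + d) * - (c + d) <=
  2 * (a * a - c * - c + (b * b - d * - d)).
  by have := sqr_ge0 (a - b); have := sqr_ge0 (c - d); rewrite !expr2; nra.
rewrite !absK_sqrE /reK /conjK; case: k x y => [x y|]; first exact: h1.
by move=> [a b] [c d]; exact: h2.
Qed.

End Scalars.

Section Riesz.
Variables (R : realType) (k : scalar_kind) (H : hilbert R k).
Local Notation K := (scalars R k).
Local Notation ip := (inner H).

Let q (x : H) : R := reK (ip x x).

Let qE x : q x = h_norm x ^+ 2.
Proof.
rewrite /q -h_normE /h_norm.
have := ofR_reK (normr_ge0 x); move: (reK _) => r ->.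
by rewrite expr2 reK_ofRM reK_ofR.
Qed.

Let q_ge0 x : 0 <= q x. Proof. by rewrite qE sqr_ge0. Qed.

Let q0 : q 0 = 0. Proof. by rewrite /q linear0l /reK; case: (k). Qed.

Let q_gt0 x : x != 0 -> 0 < q x.
Proof. by move=> /(neq0_dnorm_gt0 (s := inner H)) /reK_gt0. Qed.

Let innerC x y : ip x y = conjK (ip y x).
Proof. by have := hermitian_subproof (s := inner H) x y; rewrite expr0 mul1r. Qed.

Let qD u x a : q (u + a *: x) =
  q u + 2 * reK (a * (ip x u)) + absK a ^+ 2 * q x.
Proof.
have iZr a' y y' : ip y (a' *: y') = conjK a' * ip y y'.
  exact: (linearZr_LR (inner H)).
have iZl a' y y' : ip (a' *: y) y' = a' * ip y y'.
  exact: (linearZl_LR (inner H)).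
have iDr y y' y'' : ip y (y' + y'') = ip y y' + ip y y''.
  exact: (linearDr (inner H)).
have iDl y y' y'' : ip (y' + y'') y = ip y' y + ip y'' y.
  exact: (linearDl (inner H)).
rewrite /q iDl !iDr !iZl !iZr.
rewrite !reKD (innerC u x) -conjKM reK_conj mulrA.
have -> : ip x x = ofR k (q x).
  by apply: ofR_reK; rewrite -h_normE exprn_ge0.
rewrite [_ * ofR _ _]mulrC reK_ofRM -absK_sqrE /q reK_ofR.
by rewrite [_ * absK _ ^+ 2]mulrC mulr2n mulrDl mul1r !addrA.
Qed.

Let iB x y z : ip x (y - z) = ip x y - ip x z.
Proof. exact: (linearBr (inner H)). Qed.

Section Functional.
Variables (phi : H -> K).
Hypothesis phiD : forall u x a, phi (u + a *: x) = phi u + a * phi x.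
Let J u := q u - 2 * reK (phi u).
Let c u x := (ip x u) - phi x.

Let JD u x a : J (u + a *: x) =
  J u + 2 * reK (a * c u x) + absK a ^+ 2 * q x.
Proof. by rewrite /J /c qD phiD mulrBr !(reKD, reKN); ring. Qed.

Lemma variation m e u x : (forall v, m <= J v) -> J u <= m + e -> 
  absK (c u x) ^+ 2 <= e * q x.
Proof.
move=> mJ Ju; have [->|x0] := eqVneq x 0.
  have := phiD 0 0 (-1); rewrite scaler0 addr0 mulN1r subrr => phi0.
  have -> : c u 0 = 0 by rewrite /c linear0l phi0 subrr.
  rewrite q0 mulr0 /absK normr0 /reK; case: (k) => /=; by rewrite expr0n.
have qx0 := q_gt0 x0.
pose t := (q x)^-1.
have := mJ (u + (- (ofR k t * conjK (c u x))) *: x); rewrite JD.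
rewrite [in reK _]mulNr -mulrA reKN reK_ofRM [conjK _ * _]mulrC -absK_sqrE.
have -> : absK (- (ofR k t * conjK (c u x))) ^+ 2 = t ^+ 2 * absK (c u x) ^+ 2.
  rewrite {1}/absK normrN -/(absK _) !absK_sqrE conjKM conjKK conjK_ofR.
  rewrite -!mulrA reK_ofRM mulrCA reK_ofRM [conjK _ * _]mulrC.
  by rewrite mulrA -expr2.
move: (absK _ ^+ 2) => C JJ.
have tq : t * q x = 1 by rewrite /t mulVf ?gt_eqF.
rewrite -ler_pdivrMr// -/t mulrC.
have : m <= J u + 2 * - (t * C) + (t * C) * (t * q x) by rewrite (le_trans JJ)//; nra.
by rewrite tq; lra.
Qed.

End Functional.

Let CS x y : absK (ip x y) ^+ 2 <= q y * q x.
Proof.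
have z0 (_ _ : H) (a : K) : 0 = 0 + a * 0 :> K by rewrite mulr0 addr0.
have r0 : reK (0 : K) = 0 by rewrite -[0](ofR0 R k) reK_ofR.
have h1 v : 0 <= q v - 2 * reK (0 : K) by rewrite r0 mulr0 subr0.
have h2 : q y - 2 * reK (0 : K) <= 0 + q y by rewrite r0 mulr0 subr0 add0r.
by have := variation z0 x h1 h2; rewrite subr0.
Qed.

Section Functional.
Variables (phi : H -> K).
Hypothesis phiD : forall u x a, phi (u + a *: x) = phi u + a * phi x.
Let J u := q u - 2 * reK (phi u).
Let c u x := (ip x u) - phi x.

Let JD u x a : J (u + a *: x) =
  J u + 2 * reK (a * c u x) + absK a ^+ 2 * q x.
Proof. by rewrite /J /c qD phiD mulrBr !(reKD, reKN); ring. Qed.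

Lemma riesz_representation B : (forall x, absK (phi x) ^+ 2 <= B ^+ 2 * q x) ->
  exists z, forall x, phi x = (ip x z).
Proof.
move=> phiB.
have JB u : - B ^+ 2 <= J u.
  have := le_trans (reK_le_absK (phi u)) (phiB u).
  rewrite /J qE; move: (reK _) (h_norm _) => r h rBh.
  have X0 : 0 <= h ^+ 2 by exact: sqr_ge0.
  have Y0 : 0 <= B ^+ 2 by exact: sqr_ge0.
  move: (h ^+ 2) (B ^+ 2) rBh X0 Y0 => X Y rXY X0 Y0.
  suff : 2 * r <= X + Y by lra.
  have [r0|r0] := leP r 0; first by lra.
  rewrite -ler_sqr ?nnegrE; [|lra|lra].
  have := sqr_ge0 (X - Y); move: rXY; rewrite !expr2; nra.
pose m := inf (range J).
have hasJ : has_inf (range J).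
  split; first by exists (J 0), 0.
  by exists (- B ^+ 2) => _ [u _ <-]; exact: JB.
have mJ v : m <= J v by apply: ge_inf; [case: hasJ | exists v].
have /choice[u Ju] : forall n : nat, exists u, J u <= m + n.+1%:R^-1.
  move=> n; have n0 : 0 < n.+1%:R^-1 :> R by rewrite invr_gt0.
  by have [_ [v _ <-] /ltW] := inf_adherent n0 hasJ; exists v.
have quu i j : q (u i - u j) <= 2 * (i.+1%:R^-1 + j.+1%:R^-1).
  have J1 : J (u i) = J (u j) + 2 * reK (c (u j) (u i - u j)) + q (u i - u j).
    have := JD (u j) (u i - u j) (ofR k 1).
    rewrite reK_ofRM absK_sqrE conjK_ofR reK_ofRM reK_ofR ofR1 scale1r addrCA subrr.
    by rewrite addr0 !mul1r.
  have := mJ (u j + ofR k 2^-1 *: (u i - u j)).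
  rewrite JD reK_ofRM absK_sqrE conjK_ofR reK_ofRM reK_ofR.
  have := Ju i; have := Ju j; move: J1.
  move: (J (u i)) (J (u j)) (reK _) (q _) (i.+1%:R^-1) (j.+1%:R^-1).
  by move=> *; lra.
have norm_lt (e : K) y : 0 < e -> q y < reK e ^+ 2 -> `|y| < e.
  move=> e0; rewrite qE ltr_sqr ?nnegrE; last 2 first.
  - exact/reK_ge0/normr_ge0.
  - exact/ltW/reK_gt0.
  by move=> ye; rewrite (ofR_reK (ltW e0)) (ofR_reK (normr_ge0 y)) ofR_lt.
have /cvg_ex[z uz] : cvg (u @ \oo).
  apply/cauchy_cvgP/cauchy_exP => e e0.
  have E0 : 0 < reK e ^+ 2 / 4 by rewrite divr_gt0// exprn_gt0// reK_gt0.
  have [i _ iE] := near_infty_natSinv_lt (PosNum E0).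
  exists (u i), i => // j /= ij.
  rewrite -ball_normE /ball_ /=; apply: norm_lt => //.
  have := quu i j; have /= := iE i (leqnn i); have /= := iE j ij.
  move: (q _) (reK e ^+ 2) (i.+1%:R^-1) (j.+1%:R^-1).
  by move=> *; lra.
have key (Q X N A C I e' d' : R) : I <= Q * X -> C <= N * X ->
    A <= 2 * (I + C) -> Q <= e' -> N <= e' -> 0 <= X -> 0 < e' ->
    e' * (4 * (X + 1)) = d' -> A <= 0 + d'.
  by move=> *; nra.
exists z => x; apply/esym/eqP; rewrite -subr_eq0; apply/eqP/absK_eq0.
apply/eqP; rewrite -sqrf_eq0 eq_le sqr_ge0 andbT; apply/ler_addgt0Pr => d d0.
pose e := d / (4 * (q x + 1)).
have e0 : 0 < e by rewrite divr_gt0// mulr_gt0// ltr_pwDr.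
have se0 : 0 < ofR k (Num.sqrt e) by rewrite -[0](ofR0 R k) ofR_lt sqrtr_gt0.
have uz' : \forall n \near \oo, `|z - u n| < ofR k (Num.sqrt e).
  by move/cvgrPdist_lt : uz => /(_ _ se0).
near \oo => n.
have n0 : 0 <= n.+1%:R^-1 :> R by rewrite invr_ge0.
have ne : n.+1%:R^-1 <= e.
  by apply/ltW; near: n; exact: (near_infty_natSinv_lt (PosNum e0)).
have -> : ip x z - phi x = ip x (z - u n) + c (u n) x.
  by rewrite /c iB addrA subrK.
have := absK_sqrD (ip x (z - u n)) (c (u n) x).
have := variation phiD x mJ (Ju n).
have := CS x (z - u n).
have zu : q (z - u n) <= e.
  rewrite qE; have : `|z - u n| < ofR k (Num.sqrt e).
    by near: n; exact: uz'.
  have -> : `|z - u n| = ofR k (h_norm (z - u n)) by exact: ofR_reK.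
  rewrite ofR_lt => /ltW zu; rewrite -[leRHS]sqr_sqrtr ?ler_sqr ?nnegrE ?sqrtr_ge0 ?(ltW e0)//.
  exact/reK_ge0.
have ed : e * (4 * (q x + 1)) = d.
  by rewrite /e divfK// gt_eqF// mulr_gt0// ltr_pwDr.
move=> I_le C_le A_le; exact: (key _ _ _ _ _ _ _ _ I_le C_le A_le zu ne).
Unshelve. all: by end_near. Qed.
End Functional.

Lemma adjoint_subproof (T : bounded_op H) (y : H) :
  exists z, forall x, ip (T x) y = ip x z.
Proof.
have [r r0 Tr] : exists2 r : K, 0 < r & forall x, `|T x| <= r * `|x|.
  have /linear_boundedP /pinfty_ex_gt0 [r r0 Tr] := op_bounded T.
  by exists r.
apply: (@riesz_representation (fun x => ip (T x) y) _ (h_norm y * reK r)).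
  move=> u x a; rewrite linearD linearZ /=.
  rewrite (linearDl (inner H)); congr (_ + _).
  exact: (linearZl_LR (inner H)).
move=> x; apply: le_trans (CS _ _) _; rewrite exprMn -qE -mulrA ler_wpM2l//.
rewrite !qE -exprMn ler_sqr ?nnegrE; last 2 first.
- exact/reK_ge0/normr_ge0.
- by apply: mulr_ge0; apply: reK_ge0 => //; exact: ltW.
have rT : 0 <= r * `|x| - `|T x| by rewrite subr_ge0.
have := reK_ge0 rT.
by rewrite reKD reKN {1}(ofR_reK (ltW r0)) reK_ofRM subr_ge0.
Qed.
End Riesz.

Definition adjoint {R : realType} {k : scalar_kind} {H : hilbert R k}
    (T : bounded_op H) (y : H) : H :=
  sval (cid (adjoint_subproof T y)).

Lemma adjointP (R : realType) (k : scalar_kind) (H : hilbert R k)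
    (T : bounded_op H) (x y : H) :
  inner H (T x) y = inner H x (adjoint T y).
Proof. exact: (svalP (cid (adjoint_subproof T y))). Qed.

Definition is_tensor_op {R : realType} {k : scalar_kind} {H1 H2 : hilbert R k}
    (T : hilbert_tensor H1 H2) (K1 : bounded_op H1) (K2 : bounded_op H2)
    (K12 : bounded_op T) : Prop :=
  forall (f : H1) (g : H2), K12 (tens T f g) = tens T (K1 f) (K2 g).

Definition K_frame {R : realType} {k : scalar_kind} {n : nat}
    {H : nHilbert R k n} {a : n.-1.-tuple H} (HF : completion a)
    (K : bounded_op HF) (f : nat -> H) : Prop :=
  exists A B : R, [/\ 0 < A, 0 < B & forall h : HF,
    let S := (\sum_(i <oo) ((absK (inner HF h (h_class HF (f i)))) ^+ 2)%:E)%E in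
    ((A * h_norm (adjoint K h) ^+ 2)%:E <= S)%E /\
    (S <= (B * h_norm h ^+ 2)%:E)%E].

Definition tensor_K_frame {R : realType} {k : scalar_kind} {n : nat}
    {H1 H2 : nHilbert R k n} {a : n.-1.-tuple H1} {b : n.-1.-tuple H2}
    (HF : completion a) (KG : completion b) (T : hilbert_tensor HF KG)
    (K12 : bounded_op T) (f : nat -> H1) (g : nat -> H2) : Prop :=
  exists A B : R, [/\ 0 < A, 0 < B & forall (h : HF) (h' : KG),
    let S := (\esum_(p in [set: nat * nat])
      ((absK (inner T (tens T h h')
         (tens T (h_class HF (f p.1)) (h_class KG (g p.2))))) ^+ 2)%:E)%E in
    ((A * h_norm (adjoint K12 (tens T h h')) ^+ 2)%:E <= S)%E /\
    (S <= (B * h_norm (tens T h h') ^+ 2)%:E)%E].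

(* Main.v *)
(* On elementary tensors every quantity in the frame inequalities factors: the
   double series is the product of the two series, norms multiply, and
   (K1 (x) K2)^* (h (x) h') = K1^* h (x) K2^* h'. Multiplying the two pairs of
   inequalities gives the direct implication. Conversely, as K1, K2 <> 0 there
   are x0, y0 with K1^* x0, K2^* y0 <> 0; the inequalities at (x0, y0) force both
   series there to be positive and finite, and freezing one factor at x0 or y0
   and dividing by its series gives the inequalities for the other factor. *)
Require Import Defs.
From mathcomp Require Import all_boot all_order all_algebra.
From mathcomp Require Import complex.
From mathcomp Require Import all_classical all_reals all_analysis.
Import Order.TTheory GRing.Theory Num.Theory.
Set Implicit Arguments.
Unset Strict Implicit.
Local Open Scope classical_set_scope.
Local Open Scope ring_scope.

(** Tonelli for nonnegative terms: iterate the double sum and pull out [u i], then the sum of [v].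
    Divergent series are allowed; the convention [0 * +oo = 0] covers a null family against a
    divergent one. *)
Lemma esum_mul (R : realType) (u v : nat -> R)
    (u0 : forall i, 0 <= u i) (v0 : forall i, 0 <= v i) :
  (\esum_(p in [set: nat * nat]) (u p.1 * v p.2)%:E =
   (\sum_(i <oo) (u i)%:E) * (\sum_(i <oo) (v i)%:E))%E.
Proof.
have -> : [set: nat * nat] = [set: nat] `*`` (fun=> [set: nat]).
  by apply/seteqP; split.
rewrite -(@esum_esum _ _ _ _ _ (fun i j => (u i * v j)%:E)); last first.
  by move=> i j _ _; rewrite lee_fin mulr_ge0.
set V := (\sum_(i <oo) (v i)%:E)%E.
have V0 : (0 <= V)%E by apply: nneseries_ge0 => i _ _; rewrite lee_fin.
have inner_sum i : (\esum_(j in [set: nat]) (u i * v j)%:E = (u i)%:E * V)%E.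
  rewrite -nneseries_esumT; last by move=> j; rewrite lee_fin mulr_ge0.
  under eq_eseriesr do rewrite EFinM.
  by rewrite nneseriesZl// => j _; rewrite lee_fin.
under eq_esum do rewrite inner_sum.
case: V V0 {inner_sum} => [r| |//] V0.
- rewrite -nneseries_esumT; last by move=> i; rewrite mule_ge0 ?lee_fin.
  under eq_eseriesr do rewrite muleC.
  by rewrite nneseriesZl 1?muleC// => i _; rewrite lee_fin.
(* Here the sum of [v] is [+oo]: either [u] vanishes and both sides are 0, or one positive [u i]
   makes both sides [+oo]. *)
- have [u_eq0|] := pselect (forall i, u i = 0).
    rewrite esum1; last by move=> i _; rewrite u_eq0 mul0e.
    by rewrite eseries0 ?mul0e// => i _ _; rewrite u_eq0.
  move=> /existsNP[i /eqP ui].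
  have ui0 : (0 < u i)%R by rewrite lt_neqAle eq_sym ui u0.
  have term (w : nat -> \bar R) :
      (w i <= \esum_(j in [set: nat]) w j)%E.
    apply: esum_ge; exists [set i]; last by rewrite fsbig_set1.
    by split => //; exact: finite_set1.
  rewrite nneseries_esumT; last by move=> j; rewrite lee_fin.
  rewrite [RHS]gt0_muley; last first.
    by apply: lt_le_trans (term (fun j => (u j)%:E)).
  apply/eqP; rewrite -leye_eq.
  rewrite -[leLHS](@gt0_muley _ (u i)%:E) ?lte_fin//.
  exact: (term (fun j => (u j)%:E * +oo)%E).
Qed.

Lemma absKM (R : realType) (k : scalar_kind) (x y : scalars R k) :
  absK (x * y) = absK x * absK y.
Proof.
rewrite /absK normrM (ofR_reK (normr_ge0 x)).
by rewrite reK_ofRM reK_ofR.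
Qed.

Lemma ofRX (R : realType) (k : scalar_kind) (r : R) m :
  ofR k r ^+ m = ofR k (r ^+ m).
Proof. by rewrite /ofR; case: k => //=; rewrite -(rmorphXn (real_complex R)). Qed.

Section Hilbert.
Context {R : realType} {k : scalar_kind}.
Implicit Types H : hilbert R k.

Lemma inner_h_norm H (x : H) : inner H x x = ofR k (h_norm x ^+ 2).
Proof.
by rewrite -h_normE (ofR_reK (normr_ge0 x)) /h_norm ofRX.
Qed.

Lemma h_norm_ge0 H (x : H) : 0 <= h_norm x.
Proof. exact/reK_ge0/normr_ge0. Qed.

Lemma h_norm_eq0 H (x : H) : h_norm x = 0 -> x = 0.
Proof.
move=> x0; apply/normr0_eq0; rewrite (ofR_reK (normr_ge0 x)).
by rewrite -/(h_norm x) x0 ofR0.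
Qed.

Lemma h_norm_tens H1 H2 (T : hilbert_tensor H1 H2) (h : H1) (h' : H2) :
  h_norm (tens T h h') ^+ 2 = h_norm h ^+ 2 * h_norm h' ^+ 2.
Proof.
have := tens_inner T h h h' h'; rewrite !inner_h_norm => /(congr1 reK).
by rewrite reK_ofRM !reK_ofR.
Qed.

(* By Pythagoras a vector orthogonal to w is at distance at least |w| from w. *)
Lemma dense_orthogonal H (S : set H) (w : H) :
  dense S -> (forall x, S x -> inner H x w = 0) -> w = 0.
Proof.
move=> Sdense Sw; apply/eqP; apply: contrapT => /negP w0.
have [x [/= wx Sx]] : ball w `|w| `&` S !=set0.
  apply: Sdense; last exact: ball_open.
  by exists w; apply: ballxx; rewrite normr_gt0.
have xw := Sw x Sx.
have wx0 : inner H w x = 0.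
  have -> : inner H w x = conjK (inner H x w).
    by have := hermitian_subproof (s := inner H) w x; rewrite expr0 mul1r.
  by rewrite xw -(ofR0 R k) conjK_ofR.
move: wx; rewrite -ball_normE /ball_ /= => /lt_geF/negP; apply.
have expand : inner H (w - x) (w - x) =
    inner H w w - inner H w x - (inner H x w - inner H x x).
  by rewrite (linearBl (inner H)) /= !(linearBr (inner H)).
rewrite -ler_sqr ?nnegrE// !h_normE expand xw wx0 subr0 sub0r opprK lerDl.
by rewrite -h_normE exprn_ge0.
Qed.

(** Both sides have the same inner product with every elementary tensor, hence with the finite sums
    of these, which are dense. *)
Lemma adjoint_tens H1 H2 (T : hilbert_tensor H1 H2) (K1 : bounded_op H1)
    (K2 : bounded_op H2) (K12 : bounded_op T) (h : H1) (h' : H2) :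
  is_tensor_op K1 K2 K12 ->
  adjoint K12 (tens T h h') = tens T (adjoint K1 h) (adjoint K2 h').
Proof.
move=> K12E; apply/subr0_eq.
apply: dense_orthogonal (tens_dense (h := T)) _ => _ [s _ <-].
have innerDl (x y z : T) : inner T (x + y) z = inner T x z + inner T y z.
  exact: (linearDl (inner T)).
have innerBr (x y z : T) : inner T x (y - z) = inner T x y - inner T x z.
  exact: (linearBr (inner T)).
elim: s => [|[f g] s IHs]; first by rewrite big_nil (linear0l (inner T)).
rewrite big_cons innerDl IHs addr0 innerBr.
by rewrite -adjointP K12E !tens_inner !adjointP subrr.
Qed.

(** Take [y = K x]: if the adjoint killed it, the squared norm of [K x] would be the inner product
    of [x] with 0. *)
Lemma adjoint_neq0 H (K : bounded_op H) :
  (exists x, K x <> 0) -> exists y, 0 < h_norm (adjoint K y) ^+ 2.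
Proof.
move=> [x Kx]; exists (K x); rewrite lt0r sqr_ge0 andbT.
apply/eqP => /eqP; rewrite sqrf_eq0 => /eqP/h_norm_eq0 Ky.
have := adjointP K x (K x); rewrite Ky (linear0r (inner H)) inner_h_norm.
move=> /(congr1 reK) /eqP; rewrite reK_ofR.
have -> : reK (0 : scalars R k) = 0 by rewrite -(ofR0 R k) reK_ofR.
by rewrite sqrf_eq0 => /eqP/h_norm_eq0.
Qed.

End Hilbert.

(** The freezing argument, stated for bare functions so that it serves either tensor factor: fix
    [y0] and divide by [psi y0]. *)
Lemma factor_bounds (R : realType) (X Y : Type) (phi : X -> \bar R)
    (psi : Y -> \bar R) (M1 N1 : X -> R) (M2 N2 : Y -> R) (A B : R) x0 y0 :
  0 < A -> 0 < B -> (forall x, 0 <= phi x)%E -> (forall y, 0 <= psi y)%E ->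
  (forall x, 0 <= N1 x) -> (forall y, 0 <= N2 y) -> 0 < M1 x0 -> 0 < M2 y0 ->
  (forall x y, (A * (M1 x * M2 y))%:E <= phi x * psi y /\
     phi x * psi y <= (B * (N1 x * N2 y))%:E)%E ->
  exists A' B', [/\ 0 < A', 0 < B' & forall x,
    ((A' * M1 x)%:E <= phi x)%E /\ (phi x <= (B' * N1 x)%:E)%E].
Proof.
move=> A0 B0 phi0 psi0 N10 N20 M1x0 M2y0 bounds.
have prod_gt0 : (0 < phi x0 * psi y0)%E.
  by apply: lt_le_trans (bounds x0 y0).1; rewrite lte_fin !mulr_gt0.
have phi_gt0 : (0 < phi x0)%E.
  rewrite lt0e phi0 andbT; apply/eqP => phi_eq0.
  by move: prod_gt0; rewrite phi_eq0 mul0e ltxx.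
have psi_gt0 : (0 < psi y0)%E.
  rewrite lt0e psi0 andbT; apply/eqP => psi_eq0.
  by move: prod_gt0; rewrite psi_eq0 mule0 ltxx.
(* As [phi x0] is positive, [psi y0 = +oo] would make the product infinite, against its upper
   bound. *)
have [r psiE] : exists r, psi y0 = r%:E.
  have := (bounds x0 y0).2; case: (psi y0) psi_gt0 => [r _ _| |//].
    by exists r.
  by move=> _; rewrite gt0_muley.
have r0 : 0 < r by rewrite -lte_fin -psiE.
(* [N2 y0] is only assumed nonnegative; the added 1 makes the constant positive and, since [N1 x] is
   nonnegative, only weakens the bound. *)
exists (A * M2 y0 / r), (B * N2 y0 / r + 1); split.
- by rewrite divr_gt0 ?mulr_gt0.
- by rewrite ltr_wpDl // divr_ge0 // ?mulr_ge0 // ltW.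
move=> x; have := bounds x y0; rewrite psiE.
case: (phi x) (phi0 x) => [s s0| |//]; last first.
  by move=> _; rewrite gt0_mulye ?lte_fin// => -[_]; rewrite leye_eq.
rewrite -EFinM !lee_fin => -[lo hi]; split.
  by rewrite mulrAC ler_pdivrMr// -mulrA [M2 _ * _]mulrC.
rewrite mulrDl mul1r (@le_trans _ _ (B * N2 y0 / r * N1 x))// ?lerDl//.
by rewrite mulrAC ler_pdivlMr// -mulrA [N2 _ * _]mulrC.
Qed.

Section FrameSums.
Context {R : realType} {k : scalar_kind}.

Definition frame_sum (H : hilbert R k) (f : nat -> H) (h : H) : \bar R :=
  (\sum_(i <oo) ((absK (inner H h (f i))) ^+ 2)%:E)%E.

Lemma frame_sum_ge0 (H : hilbert R k) (f : nat -> H) (h : H) :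
  (0 <= frame_sum f h)%E.
Proof. by apply: nneseries_ge0 => i _ _; rewrite lee_fin sqr_ge0. Qed.

(** Inner products of elementary tensors factor, so each term is a product of a term in [i] and a
    term in [j]. *)
Lemma esum_tens (H1 H2 : hilbert R k) (T : hilbert_tensor H1 H2)
    (f : nat -> H1) (g : nat -> H2) (h : H1) (h' : H2) :
  (\esum_(p in [set: nat * nat])
     ((absK (inner T (tens T h h') (tens T (f p.1) (g p.2)))) ^+ 2)%:E =
   frame_sum f h * frame_sum g h')%E.
Proof.
rewrite -esum_mul; [|by move=> i; rewrite sqr_ge0..].
by apply: eq_esum => p _; rewrite tens_inner absKM exprMn.
Qed.

End FrameSums.

(** The converse asks for nonzero [K1] and [K2]: if [K1 = 0] and every [f i] is 0, the tensor
    condition holds for any [g], even one that is no [K2]-frame. *)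
Theorem theorem4p3 (R : realType) (k : scalar_kind) (n : nat) (n_gt0 : (0 < n)%N)
    (H1 H2 : nHilbert R k n) (a : n.-1.-tuple H1) (b : n.-1.-tuple H2)
    (a_indep : lin_indep a) (b_indep : lin_indep b)
    (HF : completion a) (KG : completion b) (T : hilbert_tensor HF KG)
    (K1 : bounded_op HF) (K2 : bounded_op KG) (K12 : bounded_op T)
    (K12E : is_tensor_op K1 K2 K12) (f : nat -> H1) (g : nat -> H2) :
  (K_frame K1 f /\ K_frame K2 g -> tensor_K_frame K12 f g) /\
  ((exists x : HF, K1 x <> 0) -> (exists y : KG, K2 y <> 0) ->
   tensor_K_frame K12 f g -> K_frame K1 f /\ K_frame K2 g).
Proof.
have tensE h h' : h_norm (adjoint K12 (tens T h h')) ^+ 2 =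
    h_norm (adjoint K1 h) ^+ 2 * h_norm (adjoint K2 h') ^+ 2.
  by rewrite (adjoint_tens _ _ K12E) h_norm_tens.
split.
- move=> [[A1 [B1 [A10 B10 F1]]] [A2 [B2 [A20 B20 F2]]]].
  exists (A1 * A2), (B1 * B2); split; [exact: mulr_gt0..|] => h h' /=.
  rewrite (esum_tens T (h_class HF \o f) (h_class KG \o g)) tensE h_norm_tens.
  have [lo1 hi1] := F1 h; have [lo2 hi2] := F2 h'.
  (* Multiplying two inequalities requires their smaller sides to be nonnegative. *)
  split; rewrite mulrACA EFinM; apply: lee_pmul => //;
    rewrite ?lee_fin ?mulr_ge0 ?h_norm_ge0 ?(ltW A10) ?(ltW A20) //;
    exact: frame_sum_ge0.
move=> /adjoint_neq0[x0 M1x0] /adjoint_neq0[y0 M2y0] [A [B [A0 B0 F]]].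
have sqn (H : hilbert R k) (x : H) : 0 <= h_norm x ^+ 2 by exact: sqr_ge0.
have bounds h h' : let S := (frame_sum (h_class HF \o f) h *
      frame_sum (h_class KG \o g) h')%E in
    ((A * (h_norm (adjoint K1 h) ^+ 2 * h_norm (adjoint K2 h') ^+ 2))%:E <= S)%E
    /\ (S <= (B * (h_norm h ^+ 2 * h_norm h' ^+ 2))%:E)%E.
  by have := F h h'; rewrite tensE h_norm_tens
    (esum_tens T (h_class HF \o f) (h_class KG \o g)).
split.
- exact: (factor_bounds A0 B0 (frame_sum_ge0 _) (frame_sum_ge0 _)
    (@sqn HF) (@sqn KG) M1x0 M2y0 bounds).
(* The same argument with the factors exchanged; naming [M] and [N] singles out the products to be
   commuted. *)
- pose M (h' : KG) := h_norm (adjoint K2 h') ^+ 2.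
  pose N (h' : KG) := h_norm h' ^+ 2.
  apply: (@factor_bounds _ KG HF (frame_sum (h_class KG \o g))
    (frame_sum (h_class HF \o f)) M N (fun h => h_norm (adjoint K1 h) ^+ 2)
    (fun h => h_norm h ^+ 2) A B y0 x0 A0 B0 (frame_sum_ge0 _)
    (frame_sum_ge0 _) (@sqn KG) (@sqn HF) M2y0 M1x0) => h' h.
  by have := bounds h h'; rewrite /= [M _ * _]mulrC [N _ * _]mulrC muleC.
Qed.
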